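(* Let $\mathbb{F}=\mathbb{C}(q)$ and let $\mathrm{U}_q(\mathbb{F})$ be the quantum general linear supergroup associated with $\mathfrak{gl}_{m|n}$ corresponding to any given choice of Borel subalgebra, with natural module $V_q$ and braiding $c_{V_q,V_q}:V_q\otimes V_q\to V_q\otimes V_q$. Let $B_r$ be the braid group on $r$ strings with standard generators $X_1^+,\dots,X_{r-1}^+$, and let $\nu_r$ be the representation of $B_r$ on $V_q^{\otimes r}$ given by $$\nu_r(X_i^+)=\mathrm{id}_{V_q}^{\otimes(r-i-1)}\otimes c_{V_q,V_q}\otimes\mathrm{id}_{V_q}^{\otimes(i-1)}.$$ Then $\nu_r$ factors through the Hecke algebra $H_r(q;\mathbb{F})$, i.e. the quotient of the group algebra $\mathbb{F}B_r$ by the two-sided ideal generated by $X_i^+-(X_i^+)^{-1}-(q-q^{-1})$, $i=1,\dots,r-1$.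
   Context: **Quantum supergroup.** Fix a parity sequence $[1],\dots,[m+n]\in\{0,1\}$ with exactly $m$ zeros and $n$ ones (the choice of Borel subalgebra of $\mathfrak{gl}_{m|n}$). Let $\mathcal{E}_1,\dots,\mathcal{E}_{m+n}$ be a basis of a vector space with $(\mathcal{E}_a,\mathcal{E}_b)=(-1)^{[a]}\delta_{ab}$, $\alpha_i=\mathcal{E}_i-\mathcal{E}_{i+1}$. Put $q_i=q^{(\alpha_i,\alpha_i)/2}$ if $(\alpha_i,\alpha_i)\neq0$ and $q_i=q$ otherwise. $\mathrm{U}_q(\mathbb{F})$ is the $\mathbb{F}$-superalgebra generated by $K_a^{\pm1}$ (even, $1\le a\le m+n$) and $e_i,f_i$ ($1\le i<m+n$; parity $[i]+[i+1]$ mod 2) with relations: the $K_a$ commute; $K_ae_iK_a^{-1}=q^{(\mathcal{E}_a,\alpha_i)}e_i$, $K_af_iK_a^{-1}=q^{-(\mathcal{E}_a,\alpha_i)}f_i$; $e_if_j-(-1)^{[e_i][f_j]}f_je_i=\delta_{ij}\frac{k_i-k_i^{-1}}{q_i-q_i^{-1}}$ with $k_i=K_iK_{i+1}^{-1}$; and the quantum Serre relations (including higher order ones), described uniformly: let $\tilde{\mathrm U}$ be the superalgebra with the preceding relations only, $\tilde{\mathrm U}^+=\langle e_i\rangle$, $\tilde{\mathrm U}^-=\langle f_i\rangle$, $\tilde{\mathrm U}^0=\langle K_a^{\pm1}\rangle$; impose $x=0$ for all $x$ in the largest $\mathbb{N}^{m+n-1}$-graded two-sided ideal $J^+\subset\tilde{\mathrm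 U}^+$ with zero degree-$0$ component such that the supercommutators $[x,f_j]\in\tilde{\mathrm U}^0J^+$ for all $x\in J^+$ and all $j$, and similarly for $J^-\subset\tilde{\mathrm U}^-$ with $e_j$. Coproduct: $\Delta(K_a)=K_a\otimes K_a$, $\Delta(e_i)=e_i\otimes k_i+1\otimes e_i$, $\Delta(f_i)=f_i\otimes1+k_i^{-1}\otimes f_i$. **Natural module.** $V_q$ has basis $v_1,\dots,v_{m+n}$, $v_a$ of parity $[a]$, with $K_bv_a=q^{(\mathcal{E}_a,\mathcal{E}_b)}v_a$, $e_iv_{a}=\delta_{a,i+1}v_i$, $f_iv_a=\delta_{a,i}s_iv_{i+1}$, where $s_i=1$ if $(\alpha_i,\alpha_i)\ne0$ and $s_i=(-1)^{[i]}$ otherwise. **Braiding.** $c_{V_q,V_q}=\tau\circ R_{V_q,V_q}$, $\tau(v\otimes w)=(-1)^{[v][w]}w\otimes v$, $R_{V_q,V_q}=K\Theta$, where $K$ multiplies a tensor product of weight vectors of weights $\lambda,\mu$ by $q^{(\lambda,\mu)}$ and $\Theta=\sum_\nu\Theta_\nu$, $\Theta_0=1\otimes1$, $\Theta_\nu\in \mathrm U^+_\nu\otimes \mathrm U^-_{-\nu}$, is the unique such series with $K\Theta\Delta(x)=\Delta^{op}(x)K\Theta$ for all $x$ (acting on finite-dimensional weight modules). *)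

(* Defs.v *)
From HB Require Import structures.
From mathcomp Require Import all_boot all_order all_algebra.
From mathcomp Require Import finmap.
From mathcomp Require Import boolp classical_sets functions cardinality fsbigop.
From mathcomp Require Import reals complex mxtens.
From mathcomp Require Import xfinmap monalg.

Set Implicit Arguments.
Unset Strict Implicit.
Unset Printing Implicit Defensive.

Import GRing.Theory.
Local Open Scope classical_set_scope.
Local Open Scope ring_scope.
Local Open Scope quotient_scope.

Definition subspace (F : fieldType) (V : lmodType F) (W : set V) : Prop :=
  W 0 /\ forall a u v, W u -> W v -> W (a *: u + v).

Definition subalgebra (F : fieldType) (A : lalgType F) (W : set A) : Prop :=
  [/\ subspace W, W 1 & forall x y, W x -> W y -> W (x * y)].

Definition two_sided_ideal (F : fieldType) (A : lalgType F) (I : set A) : Prop :=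
  subspace I /\ forall a x, I x -> I (a * x) /\ I (x * a).

Notation lin_span := (smallest (@subspace _ _)).
Notation generated_subalgebra := (smallest (@subalgebra _ _)).
Notation generated_ideal := (smallest (@two_sided_ideal _ _)).

(* The quotient may be zero, so it is a pzRingType with an lmodType structure rather than
   an lalgType; algebra maps out of it are ring morphisms that are scalable. *)
Section QuotientAlgebra.
Variables (F : fieldType) (A : lalgType F) (S : set A).

Lemma generated_idealP : two_sided_ideal (generated_ideal S).
Proof.
split; first split.
- by move=> I [[[]]].
- by move=> a u v Iu Iv I HI; case: (HI) => -[[_ +] _] _; apply; [apply: Iu|apply: Iv].
- by move=> a x Ix; split=> I HI; case: (HI) => -[_ /(_ a x (Ix I HI))[]].
Qed.

Definition in_ideal : {pred A} := fun x => `[< generated_ideal S x >].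

Lemma in_ideal_zmod : zmod_closed in_ideal.
Proof.
have [[H0 HD] HM] := generated_idealP.
split; first exact/asboolP.
move=> x y /asboolP Hx /asboolP Hy; apply/asboolP.
by rewrite addrC -scaleN1r; apply: HD.
Qed.
HB.instance Definition _ := GRing.isZmodClosed.Build A in_ideal in_ideal_zmod.

Lemma in_idealMl a x : x \in in_ideal -> a * x \in in_ideal.
Proof. by move=> /asboolP/(generated_idealP.2 a)[? _]; apply/asboolP. Qed.

Lemma in_idealMr a x : x \in in_ideal -> x * a \in in_ideal.
Proof. by move=> /asboolP/(generated_idealP.2 a)[_ ?]; apply/asboolP. Qed.

Lemma in_idealZ a x : x \in in_ideal -> a *: x \in in_ideal.
Proof. by rewrite -[x in a *: x]mul1r scalerAl; exact: in_idealMl. Qed.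

Definition quotalg : Type := Quotient.quot in_ideal.
HB.instance Definition _ := GRing.Zmodule.copy quotalg (Quotient.quot in_ideal).

Definition quot_pi (x : A) : quotalg := \pi_(Quotient.quot in_ideal) x.

Lemma quot_piE x y : (quot_pi x = quot_pi y) <-> (x - y \in in_ideal).
Proof.
rewrite Quotient.idealrBE; split=> [|/eqP]; last by [].
by move=> /eqP.
Qed.

Definition quot_repr (x : quotalg) : A := repr (x : Quotient.quot in_ideal).

Lemma quot_reprK x : quot_pi (quot_repr x) = x.
Proof. exact: reprK. Qed.

Lemma quot_piB : {morph quot_pi : x y / x - y}.
Proof. by move=> x y; rewrite /quot_pi raddfB. Qed.

Lemma quot_piD : {morph quot_pi : x y / x + y}.
Proof. by move=> x y; rewrite /quot_pi raddfD. Qed.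

Definition quot_mul (x y : quotalg) := quot_pi (quot_repr x * quot_repr y).
Definition quot_scale a (x : quotalg) := quot_pi (a *: quot_repr x).

Lemma quot_reprP x : x - quot_repr (quot_pi x) \in in_ideal.
Proof. by apply/quot_piE; rewrite quot_reprK. Qed.

Lemma quot_piM x y : quot_pi (x * y) = quot_mul (quot_pi x) (quot_pi y).
Proof.
apply/quot_piE; set x' := quot_repr _; set y' := quot_repr _.
have -> : x * y - x' * y' = (x - x') * y + x' * (y - y').
  by rewrite mulrBl mulrBr addrA subrK.
by apply: rpredD; [apply: in_idealMr|apply: in_idealMl]; exact: quot_reprP.
Qed.

Lemma quot_piZ a x : quot_pi (a *: x) = quot_scale a (quot_pi x).
Proof. by apply/quot_piE; rewrite -scalerBr; apply/in_idealZ/quot_reprP. Qed.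

Fact quot_mulA : associative quot_mul.
Proof.
by move=> x y z; rewrite -(quot_reprK x) -(quot_reprK y) -(quot_reprK z) -!quot_piM mulrA.
Qed.
Fact quot_mul1 : left_id (quot_pi 1) quot_mul.
Proof. by move=> x; rewrite -(quot_reprK x) -quot_piM mul1r. Qed.
Fact quot_mulr1 : right_id (quot_pi 1) quot_mul.
Proof. by move=> x; rewrite -(quot_reprK x) -quot_piM mulr1. Qed.
Fact quot_mulDl : left_distributive quot_mul +%R.
Proof.
move=> x y z; rewrite -(quot_reprK x) -(quot_reprK y) -(quot_reprK z).
by rewrite -quot_piD -!quot_piM -quot_piD mulrDl.
Qed.
Fact quot_mulDr : right_distributive quot_mul +%R.
Proof.
move=> x y z; rewrite -(quot_reprK x) -(quot_reprK y) -(quot_reprK z).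
by rewrite -quot_piD -!quot_piM -quot_piD mulrDr.
Qed.
HB.instance Definition _ := GRing.Zmodule_isPzRing.Build quotalg
  quot_mulA quot_mul1 quot_mulr1 quot_mulDl quot_mulDr.

Fact quot_scaleA a b x : quot_scale a (quot_scale b x) = quot_scale (a * b) x.
Proof. by rewrite -(quot_reprK x) -!quot_piZ scalerA. Qed.
Fact quot_scale1 : left_id 1 quot_scale.
Proof. by move=> x; rewrite -(quot_reprK x) -quot_piZ scale1r. Qed.
Fact quot_scaleDr : right_distributive quot_scale +%R.
Proof.
move=> a x y; rewrite -(quot_reprK x) -(quot_reprK y).
by rewrite -quot_piD -!quot_piZ -quot_piD scalerDr.
Qed.
Fact quot_scaleDl x : {morph quot_scale^~ x : a b / a + b}.
Proof. by move=> a b; rewrite -(quot_reprK x) -!quot_piZ -quot_piD scalerDl. Qed.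
HB.instance Definition _ := GRing.Zmodule_isLmodule.Build F quotalg
  quot_scaleA quot_scale1 quot_scaleDr quot_scaleDl.

Fact quot_scaleAl a (x y : quotalg) : a *: (x * y) = (a *: x) * y.
Proof.
rewrite -(quot_reprK x) -(quot_reprK y).
have EM u v : quot_pi u * quot_pi v = quot_pi (u * v) by rewrite quot_piM.
have EZ u : a *: quot_pi u = quot_pi (a *: u) by rewrite quot_piZ.
by rewrite EM !EZ EM scalerAl.
Qed.

Fact quot_pi_monoid : monoid_morphism quot_pi.
Proof. by split=> // x y; rewrite quot_piM. Qed.

HB.instance Definition _ := GRing.isZmodMorphism.Build A quotalg quot_pi quot_piB.
HB.instance Definition _ := GRing.isMonoidMorphism.Build A quotalg quot_pi
  quot_pi_monoid.
HB.instance Definition _ := GRing.isScalable.Build F A quotalg *:%R quot_pi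
  quot_piZ.

End QuotientAlgebra.

Section GroupAlgebra.
Variables (F : fieldType) (G : groupType).

Definition grpalg : Type := {malg F[G]}.
HB.instance Definition _ := GRing.Lmodule.copy grpalg {malg F[G]}.

Definition grp_term (g : G) (c : F) : grpalg := mkmalgU g c.
Definition grp_elt (g : G) : grpalg := grp_term g 1.

Definition grpalg_mul (x y : grpalg) : grpalg :=
  \sum_(g <- msupp x) \sum_(h <- msupp y) grp_term (g * h)%g (mcoeff g x * mcoeff h y).

Fact grpalg_mulw (X Y : {fset G}) (x y : grpalg) :
  (msupp x `<=` X)%fset -> (msupp y `<=` Y)%fset ->
  grpalg_mul x y =
  \sum_(g <- X) \sum_(h <- Y) grp_term (g * h)%g (mcoeff g x * mcoeff h y).
Proof.
move=> leX leY; rewrite /grpalg_mul (big_fset_incl _ leX) /=; last first.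
  move=> g _ /mcoeff_outdom xg.
  by rewrite big1 // => h _; rewrite xg mul0r /grp_term monalgU0.
apply: eq_bigr => g _; apply/big_fset_incl => // h _ /mcoeff_outdom ->.
by rewrite mulr0 /grp_term monalgU0.
Qed.

Fact grpalg_mulDl : left_distributive grpalg_mul +%R.
Proof.
move=> x y z.
rewrite [in RHS](grpalg_mulw (fsubsetUl _ (msupp y)) (fsubset_refl _)).
rewrite [in RHS](grpalg_mulw (fsubsetUr (msupp x) _) (fsubset_refl _)).
rewrite (grpalg_mulw (msuppD_le _ _) (fsubset_refl _)).
rewrite -big_split /=; apply: eq_bigr => g _.
rewrite -big_split /=; apply: eq_bigr => h _.
by rewrite mcoeffD mulrDl /grp_term monalgUD.
Qed.

Fact grpalg_mulDr : right_distributive grpalg_mul +%R.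
Proof.
move=> x y z.
rewrite [in RHS](grpalg_mulw (fsubset_refl _) (fsubsetUl _ (msupp z))).
rewrite [in RHS](grpalg_mulw (fsubset_refl _) (fsubsetUr (msupp y) _)).
rewrite (grpalg_mulw (fsubset_refl _) (msuppD_le _ _)).
rewrite -big_split /=; apply: eq_bigr => g _.
rewrite -big_split /=; apply: eq_bigr => h _.
by rewrite mcoeffD mulrDr /grp_term monalgUD.
Qed.

Fact grpalg_mul0l : left_zero 0 grpalg_mul.
Proof. by move=> x; rewrite /grpalg_mul msupp0 big_seq_fset0. Qed.

Fact grpalg_mul0r : right_zero 0 grpalg_mul.
Proof. by move=> x; rewrite /grpalg_mul big1 // => g _; rewrite msupp0 big_seq_fset0. Qed.

Fact grpalg_mulUU g h (a b : F) :
  grpalg_mul (grp_term g a) (grp_term h b) = grp_term (g * h)%g (a * b).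
Proof. by rewrite (grpalg_mulw msuppU_le msuppU_le) !big_seq_fset1 !mcoeffUU. Qed.

Fact grpalg_mul_suml I (r : seq I) (f : I -> grpalg) y :
  grpalg_mul (\sum_(i <- r) f i) y = \sum_(i <- r) grpalg_mul (f i) y.
Proof.
exact: (big_morph (grpalg_mul^~ y) (fun _ _ => grpalg_mulDl _ _ _) (grpalg_mul0l _)).
Qed.

Fact grpalg_mul_sumr I (r : seq I) (f : I -> grpalg) x :
  grpalg_mul x (\sum_(i <- r) f i) = \sum_(i <- r) grpalg_mul x (f i).
Proof.
exact: (big_morph (grpalg_mul x) (fun _ _ => grpalg_mulDr _ _ _) (grpalg_mul0r _)).
Qed.

Fact grpalgE (x : grpalg) : x = \sum_(g <- msupp x) grp_term g (mcoeff g x).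
Proof. exact: monalgE. Qed.

Fact grpalg_mulA : associative grpalg_mul.
Proof.
move=> x y z; rewrite (grpalgE x) !grpalg_mul_suml; apply: eq_bigr => g _.
rewrite (grpalgE y) !(grpalg_mul_suml, grpalg_mul_sumr); apply: eq_bigr => h _.
rewrite (grpalgE z) !grpalg_mul_sumr; apply: eq_bigr => k _.
by rewrite !grpalg_mulUU mulrA mulgA.
Qed.

Fact grpalg_mul1l : left_id (grp_elt 1%g) grpalg_mul.
Proof.
move=> x; rewrite [in LHS](grpalgE x) [RHS]grpalgE grpalg_mul_sumr.
by apply: eq_bigr => g _; rewrite grpalg_mulUU mul1r mul1g.
Qed.

Fact grpalg_mul1r : right_id (grp_elt 1%g) grpalg_mul.
Proof.
move=> x; rewrite [in LHS](grpalgE x) [RHS]grpalgE grpalg_mul_suml.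
by apply: eq_bigr => g _; rewrite grpalg_mulUU mulr1 mulg1.
Qed.

Fact grpalg_neq0 : grp_elt 1%g != 0.
Proof.
apply/eqP => /(congr1 (mcoeff (1%g : G))) /eqP.
by rewrite mcoeffUU mcoeff0 oner_eq0.
Qed.

HB.instance Definition _ := GRing.Zmodule_isNzRing.Build grpalg grpalg_mulA
  grpalg_mul1l grpalg_mul1r grpalg_mulDl grpalg_mulDr grpalg_neq0.

Fact grpalg_scaleAl a (x y : grpalg) : a *: (x * y) = (a *: x) * y.
Proof.
have ZU b g (c : F) : b *: grp_term g c = grp_term g (b * c).
  by apply/malgP => k; rewrite mcoeffZ !mcoeffU mulrnAr.
have ZM b u v : b *: grpalg_mul u v = grpalg_mul (b *: u) v.
  rewrite (grpalgE u) [X in _ = grpalg_mul X _]scaler_sumr.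
  rewrite !grpalg_mul_suml scaler_sumr.
  apply: eq_bigr => g _; rewrite (grpalgE v) !grpalg_mul_sumr scaler_sumr.
  by apply: eq_bigr => h _; rewrite ZU !grpalg_mulUU ZU mulrA.
exact: ZM.
Qed.
HB.instance Definition _ := GRing.Lmodule_isLalgebra.Build F grpalg
  grpalg_scaleAl.

End GroupAlgebra.

Section BraidGroup.
Variable r : nat.

(* (i, true) is the generator X_(i+1), (i, false) its inverse. *)
Definition braid_word := seq ('I_r.-1 * bool).

Inductive braid_eq : braid_word -> braid_word -> Prop :=
| braid_eq_refl u : braid_eq u u
| braid_eq_sym u v : braid_eq u v -> braid_eq v u
| braid_eq_trans u v w : braid_eq u v -> braid_eq v w -> braid_eq u w
| braid_eq_cat u u' v v' :
    braid_eq u u' -> braid_eq v v' -> braid_eq (u ++ v) (u' ++ v')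
| braid_eq_inv i b : braid_eq [:: (i, b); (i, ~~ b)] [::]
| braid_eq_far (i j : 'I_r.-1) : (i.+1 < j)%N ->
    braid_eq [:: (i, true); (j, true)] [:: (j, true); (i, true)]
| braid_eq_braid (i j : 'I_r.-1) : j = i.+1 :> nat ->
    braid_eq [:: (i, true); (j, true); (i, true)]
             [:: (j, true); (i, true); (j, true)].

Definition braid_eqb (u v : braid_word) : bool := `[< braid_eq u v >].

Fact braid_eqb_equiv : equiv_class_of braid_eqb.
Proof.
split=> [u|u v|v u w].
- by apply/asboolP; apply: braid_eq_refl.
- by apply/asboolP/asboolP; apply: braid_eq_sym.
- by move=> /asboolP uv /asboolP vw; apply/asboolP; apply: braid_eq_trans uv vw.
Qed.
Canonical braid_equiv := EquivRelPack braid_eqb_equiv.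
Canonical braid_encModRel := defaultEncModRel braid_eqb.

Definition braid := {eq_quot braid_eqb}.
HB.instance Definition _ := Choice.on braid.

Definition braid_class (u : braid_word) : braid := \pi_braid u.
Definition braid_inv_word (u : braid_word) : braid_word :=
  rev [seq (x.1, ~~ x.2) | x <- u].

Definition braid_one : braid := braid_class [::].
Definition braid_mul (x y : braid) : braid := braid_class (repr x ++ repr y).
Definition braid_inv (x : braid) : braid := braid_class (braid_inv_word (repr x)).

Fact braid_classP u v : braid_class u = braid_class v <-> braid_eq u v.
Proof.
split=> [/eqP|uv]; first by rewrite eqmodE => /asboolP.
by apply/eqP; rewrite eqmodE; apply/asboolP.
Qed.

Fact braid_reprK x : braid_class (repr x) = x. Proof. exact: reprK. Qed.

Fact braid_class_repr u : braid_eq (repr (braid_class u)) u.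
Proof. by apply/braid_classP; rewrite braid_reprK. Qed.

Fact braid_class_cat u v :
  braid_class (u ++ v) = braid_mul (braid_class u) (braid_class v).
Proof.
apply/braid_classP/braid_eq_sym.
by apply: braid_eq_cat; apply: braid_class_repr.
Qed.

Fact braid_mulA : associative braid_mul.
Proof.
move=> x y z; rewrite -(braid_reprK x) -(braid_reprK y) -(braid_reprK z).
by rewrite -!braid_class_cat catA.
Qed.
Fact braid_mul1 : left_id braid_one braid_mul.
Proof. by move=> x; rewrite -(braid_reprK x) -braid_class_cat. Qed.
Fact braid_mulr1 : right_id braid_one braid_mul.
Proof. by move=> x; rewrite -(braid_reprK x) -braid_class_cat cats0. Qed.

Fact braid_inv_wordl u : braid_eq (braid_inv_word u ++ u) [::].
Proof.
elim: u => [|[i b] u IHu]; first exact: braid_eq_refl.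
rewrite /braid_inv_word /= rev_cons cat_rcons /=.
apply: braid_eq_trans IHu; apply: braid_eq_cat; first exact: braid_eq_refl.
rewrite -[X in braid_eq _ X]cat0s -[_ :: _ :: u]/([:: (i, ~~ b); (i, b)] ++ u).
apply: braid_eq_cat; last exact: braid_eq_refl.
by have := braid_eq_inv i (~~ b); rewrite negbK.
Qed.
Fact braid_mulV : left_inverse braid_one braid_inv braid_mul.
Proof.
move=> x; rewrite -[X in braid_mul _ X]braid_reprK -braid_class_cat.
by apply/braid_classP/braid_inv_wordl.
Qed.
Fact braid_inv_wordr u : braid_eq (u ++ braid_inv_word u) [::].
Proof.
have := braid_inv_wordl (braid_inv_word u).
suff -> : braid_inv_word (braid_inv_word u) = u by [].
rewrite /braid_inv_word map_rev revK -map_comp map_id_in // => -[i b] _ /=.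
by rewrite negbK.
Qed.
Fact braid_mulrV : right_inverse braid_one braid_inv braid_mul.
Proof.
move=> x; rewrite -[X in braid_mul X _]braid_reprK -braid_class_cat.
by apply/braid_classP/braid_inv_wordr.
Qed.
HB.instance Definition _ := isGroup.Build braid
  braid_mulA braid_mul1 braid_mulr1 braid_mulV braid_mulrV.

Definition braid_gen (i : 'I_r.-1) : braid := braid_class [:: (i, true)].

End BraidGroup.

Section Hecke.
Variables (F : fieldType) (q : F) (r : nat).

Definition hecke_relator (i : 'I_r.-1) : grpalg F (braid r) :=
  grp_elt F (braid_gen i) - grp_elt F (braid_gen i)^-1%g - (q - q^-1)%:A.

Definition hecke := quotalg (range hecke_relator).

Definition hecke_elt (b : braid r) : hecke := quot_pi _ (grp_elt F b).

End Hecke.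

Section FreeAlgebra.
Variables (F : fieldType) (X : choiceType).

Definition freealg : lalgType F := {malg F[{fmonom X}]}.
Definition freegen (x : X) : freealg := mkmalgU (fmu x) 1.

Definition freeeval d (h : X -> 'M[F]_d) (p : freealg) : 'M[F]_d :=
  \sum_(w <- msupp p) mcoeff w p *: \prod_(x <- (w : seq X)) h x.

End FreeAlgebra.

Section QuantumGL.
Variables (F : fieldType) (q : F) (N : nat) (par : 'I_N -> bool).

Definition weight := 'rV[int]_N.
Definition eps (a : 'I_N) : weight := delta_mx 0 a.
Definition wform (l m : weight) : int := \sum_a (-1) ^+ par a * l 0 a * m 0 a.

(* The indices i and i+1 in {1..N} of the simple root alpha_i. *)
Definition lo (i : 'I_N.-1) : 'I_N := widen_ord (leq_pred N) i.
Definition hi (i : 'I_N.-1) : 'I_N :=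
  Ordinal (etrans (esym (ltn_predRL i N)) (ltn_ord i)).
Definition alpha (i : 'I_N.-1) : weight := eps (lo i) - eps (hi i).
Definition par_root (i : 'I_N.-1) : bool := par (lo i) (+) par (hi i).
Definition q_root (i : 'I_N.-1) : F :=
  if wform (alpha i) (alpha i) == 0 then q
  else q ^ (wform (alpha i) (alpha i) %/ 2)%Z.

(* inl (a, true) = K_a, inl (a, false) = K_a^-1,
   inr (i, true) = e_i, inr (i, false) = f_i. *)
Definition gens : Type := ('I_N * bool + 'I_N.-1 * bool)%type.
Definition par_gen (g : gens) : bool :=
  match g with inl _ => false | inr (i, _) => par_root i end.

Local Notation A := (freealg F gens).
Local Notation genK a := (freegen F (inl (a, true) : gens)).
Local Notation genKV a := (freegen F (inl (a, false) : gens)).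
Local Notation gene i := (freegen F (inr (i, true) : gens)).
Local Notation genf i := (freegen F (inr (i, false) : gens)).

Definition k_root (i : 'I_N.-1) : A := genK (lo i) * genKV (hi i).
Definition kV_root (i : 'I_N.-1) : A := genK (hi i) * genKV (lo i).

Inductive tilde_rel : A -> A -> Prop :=
| rel_KKV a : tilde_rel (genK a * genKV a) 1
| rel_KVK a : tilde_rel (genKV a * genK a) 1
| rel_KK a b : tilde_rel (genK a * genK b) (genK b * genK a)
| rel_Ke a i :
    tilde_rel (genK a * gene i * genKV a) (q ^ wform (eps a) (alpha i) *: gene i)
| rel_Kf a i :
    tilde_rel (genK a * genf i * genKV a)
              (q ^ (- wform (eps a) (alpha i)) *: genf i)
| rel_ef i j :
    tilde_rel
      (gene i * genf j - (-1) ^+ (par_root i && par_root j) *: (genf j * gene i))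
      (if i == j then (q_root i - (q_root i)^-1)^-1 *: (k_root i - kV_root i)
       else 0).

Definition tilde_relators : set A :=
  [set x | exists l r, tilde_rel l r /\ x = l - r].

Definition Utilde := quotalg tilde_relators.
Definition to_Utilde (x : A) : Utilde := quot_pi tilde_relators x.

(* Below s = true is the e (positive) side and s = false the f (negative) side. *)
Definition free0 : set A :=
  generated_subalgebra (range (fun x : 'I_N * bool => freegen F (inl x : gens))).
Definition free_half (s : bool) : set A :=
  generated_subalgebra (range (fun i => freegen F (inr (i, s) : gens))).

Definition degree := {ffun 'I_N.-1 -> nat}.
Definition degree0 : degree := [ffun=> 0%N].
Definition content (w : seq 'I_N.-1) : degree := [ffun i => count_mem i w].
Definition par_deg (nu : degree) : bool := odd (\sum_i nu i * par_root i)%N.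
Definition free_deg (s : bool) (nu : degree) : set A :=
  lin_span [set x | exists2 w, content w = nu &
                x = \prod_(i <- w) freegen F (inr (i, s) : gens)].

(* The opposite generator inr (j, ~~ s) is f_j when s = true and e_j when s = false. *)
Record serre_admissible (s : bool) (J : set Utilde) : Prop := {
  adm_sub : J `<=` to_Utilde @` free_half s;
  adm_space : subspace J;
  adm_ideal : forall u x, (to_Utilde @` free_half s) u -> J x ->
    J (u * x) /\ J (x * u);
  adm_graded : J `<=` lin_span [set x | J x /\ exists nu, (to_Utilde @` free_deg s nu) x];
  adm_deg0 : forall x, J x -> (to_Utilde @` free_deg s degree0) x -> x = 0;
  adm_comm : forall nu x j, J x -> (to_Utilde @` free_deg s nu) x ->
    let y := to_Utilde (freegen F (inr (j, ~~ s) : gens)) in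
    lin_span [set z | exists2 u, (to_Utilde @` free0) u & exists2 v, J v & z = u * v]
      (x * y - (-1) ^+ (par_deg nu && par_root j) *: (y * x))
}.

(* A sum of admissible ideals is admissible, so this union is itself the largest
   admissible ideal. *)
Definition serre_ideal (s : bool) : set Utilde :=
  \bigcup_(J in serre_admissible s) J.

(* The quotient of Utilde by the two-sided ideal generated by J^+ and J^-, written as
   a quotient of the free algebra. *)
Definition Uq_relators : set A :=
  tilde_relators `|` to_Utilde @^-1` (serre_ideal true `|` serre_ideal false).
Definition Uq := quotalg Uq_relators.
Definition to_Uq (x : A) : Uq := quot_pi Uq_relators x.

Definition Uq_deg (s : bool) (nu : degree) : set Uq := to_Uq @` free_deg s nu.

(* A finite-dimensional weight supermodule with integral weights, given by its matrices
   (acting on column vectors) in a basis of homogeneous weight vectors. *)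
Record wmodule (d : nat) := WModule {
  wm_act : {rmorphism Uq -> 'M[F]_d};
  wm_par : 'I_d -> bool;
  wm_wt : 'I_d -> weight;
  wm_scalable : scalable wm_act;
  wm_K : forall a, wm_act (to_Uq (genK a)) =
    diag_mx (\row_j q ^ wform (eps a) (wm_wt j));
  wm_super : forall g j k, wm_act (to_Uq (freegen F g)) j k != 0 ->
    wm_par j = wm_par k (+) par_gen g
}.

(* Elements of U (x) U as formal sums of pure tensors with homogeneous legs, each leg
   recorded with its parity. *)
Definition tensUU := seq ((Uq * bool) * (Uq * bool)).

Section TensorAction.
Variables (d d' : nat) (M : wmodule d) (M' : wmodule d').

(* (x (x) y)(v (x) w) = (-1)^([y][v]) x v (x) y w *)
Definition tens_act (t : tensUU) : 'M[F]_(d * d') :=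
  \sum_(z <- t)
    (wm_act M z.1.1 *m diag_mx (\row_j (-1) ^+ (z.2.2 && wm_par M j)))
    *t wm_act M' z.2.1.

Definition wt_form_act : 'M[F]_(d * d') :=
  diag_mx (\row_k q ^ wform (wm_wt M (mxtens_unindex k).1)
                            (wm_wt M' (mxtens_unindex k).2)).

End TensorAction.

Definition coprod_gen (g : gens) : tensUU :=
  let u x := (to_Uq x, false) in
  match g with
  | inl _ => [:: (u (freegen F g), u (freegen F g))]
  | inr (i, true) =>
      [:: ((to_Uq (gene i), par_root i), u (k_root i));
          (u 1, (to_Uq (gene i), par_root i))]
  | inr (i, false) =>
      [:: ((to_Uq (genf i), par_root i), u 1);
          (u (kV_root i), (to_Uq (genf i), par_root i))]
  end.

Definition tens_flip (t : tensUU) : tensUU :=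
  [seq (((-1) ^+ (z.1.2 && z.2.2) *: z.2.1, z.2.2), z.1) | z <- t].

(* Coproducts extended multiplicatively from the generators: x is an element of U
   written as a noncommutative polynomial in the generators. *)
Definition coprod_act d d' (M : wmodule d) (M' : wmodule d') (x : A) :=
  freeeval (fun g => tens_act M M' (coprod_gen g)) x.
Definition opcoprod_act d d' (M : wmodule d) (M' : wmodule d') (x : A) :=
  freeeval (fun g => tens_act M M' (tens_flip (coprod_gen g))) x.

(* For fixed M and M' only finitely many Theta_nu act by a non-zero operator, and the sum
   below is over those. *)
Definition theta_act (Theta : degree -> tensUU) d d'
    (M : wmodule d) (M' : wmodule d') : 'M[F]_(d * d') :=
  \sum_(nu \in [set: degree]) tens_act M M' (Theta nu).

Definition R_act (Theta : degree -> tensUU) d d'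
    (M : wmodule d) (M' : wmodule d') : 'M[F]_(d * d') :=
  wt_form_act M M' *m theta_act Theta M M'.

(* Theta_nu is given by a representative; a tensor in Uq_deg true nu (x) Uq_deg false nu
   has both legs of parity par_deg nu. *)
Record is_quasi_R (Theta : degree -> tensUU) : Prop := {
  theta_0 : Theta degree0 = [:: ((1, false), (1, false))];
  theta_deg : forall nu z, z \in Theta nu ->
    [/\ Uq_deg true nu z.1.1, Uq_deg false nu z.2.1,
        z.1.2 = par_deg nu & z.2.2 = par_deg nu];
  theta_intertwines : forall d d' (M : wmodule d) (M' : wmodule d') (x : A),
    R_act Theta M M' *m coprod_act M M' x
    = opcoprod_act M M' x *m R_act Theta M M'
}.

Definition super_flip d (M : wmodule d) : 'M[F]_(d * d) :=
  \matrix_(k, l) let a := mxtens_unindex k in let b := mxtens_unindex l in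
    if (a.1 == b.2) && (a.2 == b.1) then (-1) ^+ (wm_par M b.1 && wm_par M b.2)
    else 0.

Definition braiding (Theta : degree -> tensUU) d (M : wmodule d) : 'M[F]_(d * d) :=
  super_flip M *m R_act Theta M M.

Record is_natural (V : wmodule N) : Prop := {
  natural_par : forall a, wm_par V a = par a;
  natural_wt : forall a, wm_wt V a = eps a;
  natural_e : forall i, wm_act V (to_Uq (gene i)) = delta_mx (lo i) (hi i);
  natural_f : forall i, wm_act V (to_Uq (genf i)) =
    (if wform (alpha i) (alpha i) == 0 then (-1) ^+ par (lo i) else 1)
      *: delta_mx (hi i) (lo i)
}.

End QuantumGL.

Section TensorPower.
Variables (F : fieldType) (N r : nat).

Fact tens_pow_dim (j : 'I_r.-1) :
  (N ^ (r - j - 2) * (N * N) * N ^ j = N ^ r)%N.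
Proof.
have jr : (j.+1 < r)%N by rewrite -ltn_predRL.
rewrite -[(N * N)%N]/(N ^ 2)%N -!expnD; congr (N ^ _)%N.
by rewrite -addnA -subnDA addnC [(2 + j)%N]addnC subnKC // addn2.
Qed.

(* With i = j+1 this is id^(r-i-1) (x) c (x) id^(i-1) on the r-th tensor power. *)
Definition tens_at (c : 'M[F]_(N * N)) (j : 'I_r.-1) : 'M[F]_(N ^ r) :=
  castmx (tens_pow_dim j, tens_pow_dim j)
    ((1%:M : 'M_(N ^ (r - j - 2))) *t c *t (1%:M : 'M_(N ^ j))).

End TensorPower.

Definition is_representation (F : fieldType) (G : groupType) d
    (nu : G -> 'M[F]_d) : Prop :=
  nu 1%g = 1%:M /\ forall x y, nu (x * y)%g = nu x *m nu y.

(* C(q), with C = R[i] for a model R of the real numbers. *)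
Definition ratfun (R : realType) : fieldType := {fraction {poly R[i]}}.
Definition ratfun_q (R : realType) : ratfun R := tofrac 'X.

(* Main.v *)
(* A product of the [e_i] acts on [V_q] by a scalar multiple of some matrix unit [E_ab]
   with [a <= b] whose interval of simple roots is its weight, and dually for the [f_i].
   Hence [Theta] acts on [V_q (x) V_q] as the identity plus a sum over [a < b] of
   [t_ab E_ab (x) E_ba], up to sign.  The intertwining relation for [f_(b-1)], read off at
   one matrix entry, gives [t_ab] from [t_(a,b-1)], and [t_(a,a+1)] outright:
   [t_ab = (q - q^-1) (-1)^([a][b])].  On each span of [v_a (x) v_b] and [v_b (x) v_a] the
   braiding is then explicit, and it satisfies [c^2 = (q - q^-1) c + 1]. *)
Require Import Defs.
From HB Require Import structures.
From mathcomp Require Import all_boot all_algebra.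
From mathcomp Require Import boolp classical_sets fsbigop reals mxtens.
From mathcomp Require Import xfinmap monalg ring zify.

Set Implicit Arguments.
Unset Strict Implicit.
Unset Printing Implicit Defensive.

Import GRing.Theory.
Local Open Scope classical_set_scope.
Local Open Scope ring_scope.

(** * Algebra morphisms out of a quotient *)

Section QuotientLift.
Variables (F : fieldType) (A : lalgType F) (S : set A) (d : nat).
Variables (f : {rmorphism A -> 'M[F]_d}) (fZ : scalable f).
Hypothesis fS : forall x, S x -> f x = 0.

(** The kernel of [f] is itself a two-sided ideal containing [S], so it contains the smallest
    one. *)
Lemma in_ideal_lift0 x : x \in in_ideal S -> f x = 0.
Proof.
move/asboolP => /(_ [set y | f y = 0]); apply; split=> //=; split; first split.
- exact: raddf0.
- by move=> a u v /= fu fv; rewrite raddfD /= fZ fu fv scaler0 addr0.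
- by move=> a y /= fy; rewrite !rmorphM /= fy mulr0 mul0r.
Qed.

Definition quot_lift (x : quotalg S) : 'M[F]_d := f (quot_repr x).

Lemma quot_lift_pi x : quot_lift (quot_pi S x) = f x.
Proof.
apply/esym/eqP; rewrite -subr_eq0 -raddfB; apply/eqP/in_ideal_lift0.
exact: quot_reprP.
Qed.

Fact quot_lift_zmod : zmod_morphism quot_lift.
Proof.
move=> x y; rewrite -(quot_reprK x) -(quot_reprK y) -raddfB !quot_lift_pi.
exact: raddfB.
Qed.

Fact quot_lift_monoid : monoid_morphism quot_lift.
Proof.
split=> [|x y]; first by rewrite -(rmorph1 (quot_pi S)) quot_lift_pi rmorph1.
rewrite -(quot_reprK x) -(quot_reprK y) -rmorphM !quot_lift_pi.
exact: rmorphM.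
Qed.

HB.instance Definition _ := GRing.isZmodMorphism.Build (quotalg S) 'M[F]_d
  quot_lift quot_lift_zmod.
HB.instance Definition _ := GRing.isMonoidMorphism.Build (quotalg S) 'M[F]_d
  quot_lift quot_lift_monoid.

Lemma quot_lift_scalable : scalable quot_lift.
Proof.
move=> a x; rewrite -(quot_reprK x).
have -> : a *: quot_pi S (quot_repr x) = quot_pi S (a *: quot_repr x).
  by rewrite linearZ.
by rewrite !quot_lift_pi fZ.
Qed.

Lemma quotalg_factor : exists g : {rmorphism quotalg S -> 'M[F]_d},
  scalable g /\ forall x, g (quot_pi S x) = f x.
Proof.
exists quot_lift; split; [exact: quot_lift_scalable | exact: quot_lift_pi].
Qed.

End QuotientLift.

(** * Representations of the group algebra and of the Hecke algebra *)

Section GroupAlgebraLift.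
Variables (F : fieldType) (G : groupType) (d : nat) (rho : G -> 'M[F]_d).
Hypothesis rho_rep : is_representation rho.

Definition grpalg_lift (x : grpalg F G) : 'M[F]_d :=
  \sum_(g <- msupp x) mcoeff g x *: rho g.

Lemma grpalg_lift_widen (X : {fset G}) (x : grpalg F G) :
  (msupp x `<=` X)%fset -> grpalg_lift x = \sum_(g <- X) mcoeff g x *: rho g.
Proof.
move=> leX; rewrite /grpalg_lift (big_fset_incl _ leX) // => g _.
by move=> /mcoeff_outdom ->; rewrite scale0r.
Qed.

Lemma grpalg_lift_term g c : grpalg_lift (grp_term g c) = c *: rho g.
Proof. by rewrite (grpalg_lift_widen msuppU_le) big_seq_fset1 mcoeffUU. Qed.

Lemma grpalg_lift_linear a x y :
  grpalg_lift (a *: x + y) = a *: grpalg_lift x + grpalg_lift y.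
Proof.
pose X := (msupp x `|` msupp y `|` msupp (a *: x + y))%fset.
rewrite (@grpalg_lift_widen X (a *: x + y)) ?fsubsetUr //.
rewrite (@grpalg_lift_widen X x) ?(@grpalg_lift_widen X y) /X.
- rewrite scaler_sumr -big_split /=; apply: eq_bigr => g _.
  by rewrite mcoeffD mcoeffZ scalerDl scalerA.
- by rewrite -fsetUA fsubsetU // fsubsetUl orbT.
- by rewrite -fsetUA fsubsetUl.
Qed.

Fact grpalg_lift_zmod : zmod_morphism grpalg_lift.
Proof. by move=> x y; rewrite addrC -scaleN1r grpalg_lift_linear scaleN1r addrC. Qed.

HB.instance Definition _ := GRing.isZmodMorphism.Build (grpalg F G) 'M[F]_d
  grpalg_lift grpalg_lift_zmod.

Fact grpalg_lift_monoid : monoid_morphism grpalg_lift.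
Proof.
have [rho1 rhoM] := rho_rep.
split=> [|x y]; first by rewrite [LHS]grpalg_lift_term rho1 scale1r.
rewrite -[x * y]/(grpalg_mul x y) /grpalg_mul raddf_sum mulr_suml.
apply: eq_bigr => g _; rewrite raddf_sum mulr_sumr; apply: eq_bigr => h _ /=.
by rewrite grpalg_lift_term rhoM -[RHS]/(_ *m _) -scalemxAl -scalemxAr scalerA.
Qed.

HB.instance Definition _ := GRing.isMonoidMorphism.Build (grpalg F G) 'M[F]_d
  grpalg_lift grpalg_lift_monoid.

Lemma grpalg_extend : exists f : {rmorphism grpalg F G -> 'M[F]_d},
  scalable f /\ forall g, f (grp_elt F g) = rho g.
Proof.
exists grpalg_lift; split=> [a x|g] /=; last by rewrite grpalg_lift_term scale1r.
by rewrite -[a *: x]addr0 grpalg_lift_linear raddf0 addr0.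
Qed.

End GroupAlgebraLift.

(** Multiplying the quadratic relation by the inverse of [rho (braid_gen i)], which is [rho] of the
    inverse braid, turns it into the Hecke relation. The linear extension of [rho] to the group
    algebra therefore kills every relator. *)
Lemma hecke_factor (F : fieldType) (q : F) (r d : nat)
    (rho : braid r -> 'M[F]_d) :
  is_representation rho ->
  (forall i, rho (braid_gen i) *m rho (braid_gen i) =
     (q - q^-1) *: rho (braid_gen i) + 1%:M) ->
  exists f : {rmorphism hecke q r -> 'M[F]_d},
    scalable f /\ forall b, f (hecke_elt q b) = rho b.
Proof.
move=> rho_rep quad; have [f [fZ fE]] := grpalg_extend rho_rep.
have fS x : range (@hecke_relator F q r) x -> f x = 0.
  move=> [i _ <-]; rewrite /hecke_relator !raddfB /= fZ rmorph1 !fE.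
  have [rho1 rhoM] := rho_rep.
  have gV : rho (braid_gen i) *m rho (braid_gen i)^-1%g = 1%:M.
    by rewrite -rhoM mulgV.
  have := congr1 (mulmx^~ (rho (braid_gen i)^-1%g)) (quad i).
  rewrite -mulmxA mulmxDl -scalemxAl gV mulmx1 mul1mx => ->.
  by rewrite addrK subrr.
have [g [gZ gE]] := quotalg_factor fZ fS.
by exists g; split=> // b; rewrite [LHS]gE fE.
Qed.

(** * Tensor products of matrices *)

Lemma mxtens_index_eq m n (a c : 'I_m) (b d : 'I_n) :
  (mxtens_index (a, b) == mxtens_index (c, d)) = (a == c) && (b == d).
Proof. by rewrite (inj_eq (can_inj (@mxtens_indexK _ _))) xpair_eqE. Qed.

Section TensorPowers.
Variables (F : fieldType) (N r : nat).
Implicit Types c : 'M[F]_(N * N).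

Lemma tens_at_mul c c' (j : 'I_r.-1) :
  tens_at c j *m tens_at c' j = tens_at (c *m c') j.
Proof.
(* Once the equality of dimensions is generalized, eliminating it replaces [N ^ r] by the product
   and the casts become trivial. *)
rewrite /tens_at; move: (tens_pow_dim N j).
case: _ / => /=; by rewrite !castmx_id !tensmx_mul !mulmx1.
Qed.

Lemma tens_at_linear a c c' (j : 'I_r.-1) :
  tens_at (a *: c + c') j = a *: tens_at c j + tens_at c' j.
Proof.
apply/matrixP => k l.
by rewrite !mxE !castmxE !mxE mulrDr mulrDl; congr (_ + _); ring.
Qed.

Lemma tens_at1 (j : 'I_r.-1) : tens_at (1%:M : 'M[F]_(N * N)) j = 1%:M.
Proof.
have tens11 m n : (1%:M : 'M[F]_m) *t (1%:M : 'M[F]_n) = 1%:M.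
  apply/matrixP => k l.
  case: (mxtens_indexP k) => i1 i2; case: (mxtens_indexP l) => j1 j2.
  by rewrite tensmxE !mxE mxtens_index_eq -natrM mulnb.
rewrite /tens_at !tens11; move: (tens_pow_dim N j).
by case: _ / => /=; rewrite castmx_id.
Qed.

End TensorPowers.

Section TensorBasis.
Variables (F : fieldType) (m n : nat).

(* Operators are compared through their rows, so they act on these row vectors from the
   right: this is the basis dual to the [v_a (x) v_b]. *)
Definition tens_basis (a : 'I_m) (b : 'I_n) : 'rV[F]_(m * n) :=
  delta_mx 0 (mxtens_index (a, b)).

Lemma tens_basis_mul (A : 'M[F]_m) (B : 'M[F]_n) a b c d x y :
  delta_mx 0 a *m A = x *: (delta_mx 0 c : 'rV_m) ->
  delta_mx 0 b *m B = y *: (delta_mx 0 d : 'rV_n) ->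
  tens_basis a b *m (A *t B) = (x * y) *: tens_basis c d.
Proof.
rewrite -!rowE => /rowP Ac /rowP Bd; apply/rowP => k.
case: (mxtens_indexP k) => i j; move: (Ac i) (Bd j).
rewrite !mxE !eqxx !mxtens_indexK /= mxtens_index_eq => -> ->.
by rewrite -mulnb natrM; ring.
Qed.

Lemma tens_basisE a b (A : 'M[F]_(m * n)) :
  tens_basis a b *m A = row (mxtens_index (a, b)) A.
Proof. by rewrite rowE. Qed.

Lemma tens_basis_ext (A B : 'M[F]_(m * n)) :
  (forall a b, tens_basis a b *m A = tens_basis a b *m B) -> A = B.
Proof.
move=> AB; apply/row_matrixP => k; case: (mxtens_indexP k) => a b.
by rewrite -!tens_basisE.
Qed.

End TensorBasis.

(** * Weights and the action of the generators *)

Section WeightForm.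
Variables (N : nat) (par : 'I_N -> bool).

Lemma wform_eps a b : wform par (eps a) (eps b) = if a == b then (-1) ^+ par a else 0.
Proof.
rewrite /wform (bigD1 a) //= big1 => [|c ca].
  by rewrite !mxE !eqxx /= addr0 mulr1; case: eqP; rewrite ?mulr1 ?mulr0.
by rewrite !mxE (negbTE ca) andbF mulr0 mul0r.
Qed.

End WeightForm.

Section ModuleAction.
Variables (F : fieldType) (q : F) (N : nat) (par : 'I_N -> bool).
Variables (d : nat) (M : wmodule q par d).
Hypothesis q0 : q != 0.
Local Notation A := (freealg F (gens N)).
Local Notation gen g := (freegen F (g : gens N)).

Definition free_act (x : A) : 'M[F]_d := wm_act M (to_Uq q par x).

Lemma free_act_linear a x y : free_act (a *: x + y) = a *: free_act x + free_act y.
Proof.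
rewrite /free_act /to_Uq -(wm_scalable M) -raddfD.
congr (wm_act M _).
by rewrite raddfD; congr (_ + _); exact: quot_piZ.
Qed.

Lemma free_actM x y : free_act (x * y) = free_act x *m free_act y.
Proof. by rewrite /free_act /to_Uq !rmorphM. Qed.

Lemma free_act1 : free_act 1 = 1%:M.
Proof. by rewrite /free_act /to_Uq !rmorph1. Qed.

(** [wmodule] prescribes only the action of [K_a]. The relation [rel_KVK] makes the unknown matrix a
    left inverse of a diagonal matrix whose right inverse is explicit. *)
Lemma free_act_KV a : free_act (gen (inl (a, false))) =
  diag_mx (\row_j q ^ (- wform par (eps a) (wm_wt M j))).
Proof.
have KVK : free_act (gen (inl (a, false))) *m free_act (gen (inl (a, true))) = 1%:M.
  rewrite -free_actM -free_act1; congr (wm_act M _); apply/quot_piE/asboolP.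
  by move=> I [_]; apply; left; exists (gen (inl (a, false)) * gen (inl (a, true))), 1;
     split=> //; exact: rel_KVK.
pose D z : 'M[F]_d := diag_mx (\row_j q ^ (z * wform par (eps a) (wm_wt M j))).
have DD : D 1 *m D (-1) = 1%:M.
  rewrite /D mulmx_diag -diag_const_mx; congr diag_mx; apply/rowP => j.
  by rewrite !mxE -expfzDr // -mulrDl subrr mul0r expr0z.
have K1 : free_act (gen (inl (a, true))) = D 1.
  rewrite /free_act wm_K; congr diag_mx; apply/rowP => j.
  by rewrite !mxE mul1r.
rewrite K1 in KVK.
rewrite -[LHS]mulmx1 -DD mulmxA KVK mul1mx /D; congr diag_mx; apply/rowP => j.
by rewrite !mxE mulN1r.
Qed.

Lemma free_act_kV i : free_act (kV_root F i) =
  diag_mx (\row_j q ^ (wform par (eps (hi i)) (wm_wt M j)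
                       - wform par (eps (lo i)) (wm_wt M j))).
Proof.
rewrite free_actM free_act_KV /free_act wm_K mulmx_diag; congr diag_mx.
by apply/rowP => j; rewrite !mxE expfzDr.
Qed.

End ModuleAction.

Lemma freeeval_gen (F : fieldType) (X : choiceType) d (h : X -> 'M[F]_d) x :
  freeeval h (freegen F x) = h x.
Proof.
by rewrite /freeeval msuppU1 big_seq_fset1 mcoeffUU scale1r fmuE /= big_seq1.
Qed.

(** * Degrees that are intervals of simple roots *)

Section Interval.
Variable N : nat.

(** For [i <= j] these are the coordinates of [eps i - eps j] in the simple roots, that is, the
    weight of the matrix unit [E_ij]. *)
Definition interval (i j : 'I_N) : degree N :=
  [ffun k : 'I_N.-1 => nat_of_bool (i <= k < j)%N].

Lemma interval_nil (i : 'I_N) : interval i i = degree0 N.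
Proof. by apply/ffunP => k; rewrite !ffunE; case: leqP. Qed.

Lemma interval_inj (i j i' j' : 'I_N) : (i < j)%N -> (i' < j')%N ->
  interval i j = interval i' j' -> i = i' /\ j = j'.
Proof.
(* Testing the first index [a] and the last index [b.-1] of a nonempty interval gives containment;
   both directions together identify the endpoints. *)
have half (a b c e : 'I_N) : (a < b)%N -> interval a b = interval c e ->
    (c <= a)%N && (b <= e)%N.
  move=> ab /ffunP E; have ltb := ltn_ord b.
  have aN : (a < N.-1)%N by lia.
  have bN : (b.-1 < N.-1)%N by lia.
  by move: (E (Ordinal aN)) (E (Ordinal bN)); rewrite !ffunE /=; lia.
move=> ij ij' E; have := half _ _ _ _ ij E; have := half _ _ _ _ ij' (esym E).
by move=> H1 H2; split; apply/val_inj => /=; lia.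
Qed.

Lemma content_nil : content [::] = degree0 N.
Proof. by apply/ffunP => k; rewrite !ffunE. Qed.

Lemma content_cons_lo k w (j : 'I_N) :
  (hi k <= j)%N -> content w = interval (hi k) j ->
  content (k :: w) = interval (lo k) j.
Proof.
move=> kj /ffunP E; apply/ffunP => l; move: (E l); rewrite !ffunE /= => ->.
by rewrite -val_eqE /=; move: kj => /=; lia.
Qed.

Lemma content_cons_hi k w (j : 'I_N) :
  (j <= lo k)%N -> content w = interval j (lo k) ->
  content (k :: w) = interval j (hi k).
Proof.
move=> kj /ffunP E; apply/ffunP => l; move: (E l); rewrite !ffunE /= => ->.
by rewrite -val_eqE /=; move: kj => /=; lia.
Qed.

End Interval.

Lemma delta_mulmxE (F : fieldType) m n p (i : 'I_m) (j : 'I_n) (A : 'M[F]_(n, p)) k l :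
  (delta_mx i j *m A) k l = (k == i)%:R * A j l.
Proof.
rewrite mxE (bigD1 j) //= big1 => [|h hj]; first by rewrite mxE eqxx andbT addr0.
by rewrite mxE (negbTE hj) andbF mul0r.
Qed.

(** * The natural module *)

Section NaturalModule.
Variables (F : fieldType) (q : F) (N : nat) (par : 'I_N -> bool).
Hypothesis q0 : q != 0.
Variables (V : wmodule q par N) (V_nat : is_natural V).
Local Notation gen g := (freegen F (g : gens N)).
Local Notation e a := (delta_mx 0 a : 'rV[F]_N).
Local Notation v a b := (tens_basis F a b : 'rV[F]_(N * N)).

Definition f_coef (i : 'I_N.-1) : F :=
  if wform par (alpha i) (alpha i) == 0 then (-1) ^+ par (lo i) else 1.

Lemma f_coef_neq0 i : f_coef i != 0.
Proof. by rewrite /f_coef; case: ifP; rewrite ?signr_eq0 ?oner_eq0. Qed.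

Lemma free_act_e i : free_act V (gen (inr (i, true))) = delta_mx (lo i) (hi i).
Proof. exact: natural_e. Qed.

Lemma free_act_f i :
  free_act V (gen (inr (i, false))) = f_coef i *: delta_mx (hi i) (lo i).
Proof. exact: natural_f. Qed.

(** The leading letter acts by a multiple of a matrix unit: it pins the row [i] and leaves an entry
    of the remaining word in an adjacent row. The interval grows by one simple root, at its lower
    end for [e] and at its upper end for [f]. *)
Lemma free_act_word s (w : seq 'I_N.-1) i j :
  free_act V (\prod_(k <- w) gen (inr (k, s))) i j != 0 ->
  if s then (i <= j)%N /\ content w = interval i j
  else (j <= i)%N /\ content w = interval j i.
Proof.
elim: w i j => [|k w IHw] i j.
  rewrite big_nil free_act1 mxE content_nil.
  by have [->|] := eqVneq i j; rewrite ?eqxx // interval_nil; case: s.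
rewrite big_cons free_actM; case: s IHw => IHw.
  rewrite free_act_e delta_mulmxE; have [->|] := eqVneq i; last by rewrite mul0r eqxx.
  rewrite mul1r => /IHw[kj E]; split; last exact: content_cons_lo.
  by move: kj => /=; lia.
rewrite free_act_f -scalemxAl mxE delta_mulmxE.
have [->|] := eqVneq i; last by rewrite mul0r mulr0 eqxx.
rewrite mul1r mulf_eq0 negb_or => /andP[_ /IHw[kj E]].
split; last exact: content_cons_hi.
by move: kj => /=; lia.
Qed.

Lemma free_act_deg s nu x i j : free_deg s nu x -> free_act V x i j != 0 ->
  if s then (i <= j)%N /\ nu = interval i j
  else (j <= i)%N /\ nu = interval j i.
Proof.
pose P := if s then (i <= j)%N /\ nu = interval i j
  else (j <= i)%N /\ nu = interval j i.
(* [P] does not depend on the element, so the elements satisfying this implication form a subspace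
   and it is enough to treat words. *)
rewrite -/P => /(_ [set y | free_act V y i j != 0 -> P]); apply.
split; first split.
- rewrite /= -[0](addrN 1) -scaleN1r addrC free_act_linear scaleN1r addNr.
  by rewrite mxE eqxx.
- move=> a u v /= Pu Pv; rewrite free_act_linear !mxE.
  have [u0|/Pu //] := eqVneq (free_act V u i j) 0.
  by rewrite u0 mulr0 add0r.
- by move=> y [w Ew ->] /free_act_word; rewrite Ew.
Qed.

Lemma Uq_deg_act s nu (x : Uq q par) i j : Uq_deg s nu x -> wm_act V x i j != 0 ->
  if s then (i <= j)%N /\ nu = interval i j
  else (j <= i)%N /\ nu = interval j i.
Proof. by move=> [y + <-]; exact: free_act_deg. Qed.

(** * The action of [Theta] on the tensor square *)

Section Theta.
Variables (Theta : degree N -> tensUU q par) (Theta_qR : is_quasi_R Theta).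
Local Notation T := (theta_act Theta V V).
Local Notation idx a b := (mxtens_index (a, b)).

(** Both legs have the same degree up to sign: a nonzero entry forces [nu] to be both [interval a c]
    and [interval d b]. As [nu] is nonzero these are nonempty, so [a = d] and [c = b]. *)
Lemma tens_act_Theta_eq0 (nu : degree N) (a b c d : 'I_N) : nu != degree0 N ->
  ~~ [&& (a < b)%N, c == b & d == a] ->
  tens_act V V (Theta nu) (idx a b) (idx c d) = 0.
Proof.
move=> nu0 abcd; rewrite /tens_act summxE big1_seq // => z /andP[_ zT].
rewrite tensmxE mul_mx_diag mxE.
have [z1 z2 _ _] := theta_deg Theta_qR zT.
have [->|/(Uq_deg_act z1)[ac Eac]] := eqVneq (wm_act V z.1.1 a c) 0.
  by rewrite !mul0r.
have [->|/(Uq_deg_act z2)[db Edb]] := eqVneq (wm_act V z.2.1 b d) 0.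
  by rewrite mulr0.
have ltac : (a < c)%N.
  rewrite ltn_neqAle ac andbT; apply: contra_neq nu0 => /val_inj E.
  by rewrite Eac E interval_nil.
have ltdb : (d < b)%N.
  rewrite ltn_neqAle db andbT; apply: contra_neq nu0 => /val_inj E.
  by rewrite Edb E interval_nil.
have [E1 E2] := interval_inj ltac ltdb (etrans (esym Eac) Edb).
by move: abcd; rewrite E2 -E1 -{1}E2 ltac !eqxx.
Qed.

Lemma tens_act_Theta0 : tens_act V V (Theta (degree0 N)) = 1%:M.
Proof.
rewrite (theta_0 Theta_qR) /tens_act big_seq1 /= rmorph1.
apply: tens_basis_ext => a b.
have E c : e c *m (1%:M : 'M[F]_N) = 1 *: e c by rewrite mulmx1 scale1r.
rewrite (@tens_basis_mul _ _ _ _ _ a b a b 1 1) ?E //.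
  by rewrite mulmx1 mulr1 scale1r.
rewrite mul1mx; apply/rowP => j; rewrite mul_mx_diag !mxE.
by rewrite eqxx expr0 mulr1 mul1r.
Qed.

Lemma theta_actE (a b c d : 'I_N) : T (idx a b) (idx c d) =
  ((a == c) && (b == d))%:R +
  (if [&& (a < b)%N, c == b & d == a] then T (idx a b) (idx b a) else 0).
Proof.
have [/and3P[ab /eqP-> /eqP->]|abcd] := boolP [&& (a < b)%N, c == b & d == a].
  by rewrite -val_eqE (ltn_eqF ab) add0r.
(* [theta_act] is a junk 0 unless the sum over [nu] has finite support; [A] contains it. *)
pose A := (degree0 N |` [fset x in [seq interval p.1 p.2 | p : 'I_N * 'I_N]])%fset.
rewrite /theta_act (fsbigTE A) => [|nu]; last first.
  rewrite !inE negb_or => /andP[nu0 /negP nuA]; apply/matrixP => k l.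
  case: (mxtens_indexP k) => i j; case: (mxtens_indexP l) => i' j'.
  rewrite [RHS]mxE; have [/and3P[ij /eqP ? /eqP ?]|] :=
    boolP [&& (i < j)%N, i' == j & j' == i]; last exact: tens_act_Theta_eq0.
  (* At such an entry only the degree [interval i j] can contribute, and it lies in [A]. *)
  subst; rewrite /tens_act summxE big1_seq // => z /andP[_ zT].
  have [z1 _ _ _] := theta_deg Theta_qR zT.
  rewrite tensmxE mul_mx_diag mxE.
  have [->|/(Uq_deg_act z1)[_ E]] := eqVneq (wm_act V z.1.1 i j) 0.
    by rewrite !mul0r.
  by case: nuA; apply/mapP; exists (i, j); rewrite ?mem_enum.
rewrite (big_fsetD1 (degree0 N)) ?inE ?eqxx //= tens_act_Theta0 mxE summxE addr0.
rewrite big1_seq ?addr0 => [|nu /andP[_]]; last first.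
  by rewrite !inE => /andP[nu0 _]; rewrite tens_act_Theta_eq0.
by rewrite !mxE mxtens_index_eq.
Qed.

(** Taken as a matrix entry, this already includes the sign from moving an odd second leg past the
    first vector. *)
Definition theta_coef (a b : 'I_N) : F := T (idx a b) (idx b a).
Local Notation t := theta_coef.

Lemma tens_basis_wt a b : v a b *m wt_form_act V V =
  q ^ (if a == b then (-1) ^+ par a else 0) *: v a b.
Proof.
apply/rowP => j; rewrite mul_mx_diag !mxE mulrC; have [->|] := eqVneq j; last first.
  by move=> _; rewrite andbF !mulr0.
by rewrite mxtens_indexK !natural_wt // wform_eps.
Qed.

Lemma tens_basis_theta a b : v a b *m T = v a b + (if (a < b)%N then t a b *: v b a else 0).
Proof.
rewrite tens_basisE; apply/rowP => k; case: (mxtens_indexP k) => c d.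
rewrite mxE theta_actE // !mxE mxtens_index_eq.
rewrite eqxx (eq_sym a) (eq_sym b d); congr (_ + _).
case: (a < b)%N => /=; last by rewrite mxE.
rewrite !mxE mxtens_index_eq eqxx /=.
by case: (_ && _); rewrite ?mulr1 ?mulr0.
Qed.

(** Row vectors meet the weight factor before [Theta]. For [a < b] that factor is [q ^ 0], so the
    off-diagonal term carries no power of [q]. *)
Lemma tens_basis_R a b : v a b *m R_act Theta V V =
  q ^ (if a == b then (-1) ^+ par a else 0) *: v a b +
  (if (a < b)%N then t a b *: v b a else 0).
Proof.
rewrite mulmxA tens_basis_wt -scalemxAl tens_basis_theta scalerDr; congr (_ + _).
by case: ltnP; rewrite ?scaler0 // -val_eqE => /ltn_eqF ->; rewrite scale1r.
Qed.

Lemma tens_basis_flip a b : v a b *m super_flip V = (-1) ^+ (par a && par b) *: v b a.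
Proof.
rewrite tens_basisE; apply/rowP => k; case: (mxtens_indexP k) => c d.
rewrite !mxE !mxtens_indexK /= !natural_par // mxtens_index_eq.
rewrite (eq_sym c) (eq_sym d).
have [->|_] := eqVneq b c; last by rewrite andbF mulr0.
have [->|_] := eqVneq a d; last by rewrite mulr0.
by rewrite andbC mulr1.
Qed.

(** * Intertwining with the coproduct of [f_i] *)

Local Notation f i := (gen (inr (i, false))).
Local Notation sg i a := ((-1) ^+ (par_root par i && par a)).

(** On row vectors [f_i] acts by its transpose, hence goes from [hi i] down to [lo i]. *)
Lemma row_free_act_f a i :
  e a *m free_act V (f i) = (if a == hi i then f_coef i else 0) *: e (lo i).
Proof.
rewrite free_act_f // -scalemxAr mul_delta_mx_cond.
by case: eqVneq; rewrite ?mulr0n ?mulr1n ?scaler0 ?scale0r.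
Qed.

Lemma row_signed a i : e a *m diag_mx (\row_j (-1) ^+ (par_root par i && wm_par V j)) =
  sg i a *: e a.
Proof.
apply/rowP => j; rewrite mul_mx_diag !mxE mulrC natural_par //.
by have [->|_] := eqVneq j a; rewrite ?andbF ?mulr0.
Qed.

Lemma row_free_act_kV a i : e a *m free_act V (kV_root F i) =
  q ^ (wform par (eps (hi i)) (eps a) - wform par (eps (lo i)) (eps a)) *: e a.
Proof.
rewrite free_act_kV //; apply/rowP => j; rewrite mul_mx_diag !mxE mulrC natural_wt //.
by have [->|_] := eqVneq j a; rewrite ?andbF ?mulr0.
Qed.

Lemma row_unsigned (a : 'I_N) : e a *m diag_mx (\row_j (-1) ^+ (false && wm_par V j)) = 1 *: e a.
Proof. by rewrite scale1r; apply/rowP => j; rewrite mul_mx_diag !mxE mulr1. Qed.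

Lemma coprod_act_f_row a b i : v a b *m coprod_act V V (f i) =
  (if a == hi i then f_coef i else 0) *: v (lo i) b +
  (if b == hi i then f_coef i *
     q ^ (wform par (eps (hi i)) (eps a) - wform par (eps (lo i)) (eps a)) * sg i a
   else 0) *: v a (lo i).
Proof.
rewrite /coprod_act freeeval_gen /tens_act /coprod_gen !big_cons big_nil addr0 /=.
rewrite -!/(free_act V _) mulmxDr; congr (_ + _).
  rewrite (@tens_basis_mul _ _ _ _ _ a b (lo i) b
    (if a == hi i then f_coef i else 0) 1) ?mulr1 //.
    by rewrite mulmxA row_free_act_f -scalemxAl row_unsigned scale1r.
  by rewrite -/(to_Uq q par 1) -/(free_act V 1) free_act1 mulmx1 scale1r.
rewrite (tens_basis_mul (c := a)
  (x := q ^ (wform par (eps (hi i)) (eps a) - wform par (eps (lo i)) (eps a)) * sg i a)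
  _ (row_free_act_f b i)).
  by case: eqVneq => _; rewrite ?mulr0 //; congr (_ *: _); ring.
by rewrite mulmxA row_free_act_kV -scalemxAl row_signed scalerA.
Qed.

Lemma opcoprod_act_f_row a b i : v a b *m opcoprod_act V V (f i) =
  (if b == hi i then f_coef i * sg i a else 0) *: v a (lo i) +
  (if a == hi i then f_coef i *
     q ^ (wform par (eps (hi i)) (eps b) - wform par (eps (lo i)) (eps b))
   else 0) *: v (lo i) b.
Proof.
rewrite /opcoprod_act freeeval_gen /tens_act /coprod_gen /= !big_cons big_nil addr0 /=.
(* The flip introduces no sign, since each summand of the coproduct has an even leg. *)
rewrite andbF expr0 !scale1r.
rewrite -!/(free_act V _) mulmxDr; congr (_ + _).
  rewrite (tens_basis_mul (c := a) (x := sg i a) _ (row_free_act_f b i)).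
    by case: eqVneq => _; rewrite ?mulr0 // mulrC.
  by rewrite -/(to_Uq q par 1) -/(free_act V 1) free_act1 mul1mx row_signed.
rewrite (tens_basis_mul (c := lo i) (x := if a == hi i then f_coef i else 0)
  _ (row_free_act_kV b i)).
  by case: eqVneq => _; rewrite ?mul0r.
by rewrite mulmxA row_free_act_f -scalemxAl row_unsigned scale1r.
Qed.

(** Both sides of the intertwining relation are applied to the row vector [v a (hi i)]; the
    coefficient of [v (lo i) a] isolates [t a (hi i)]. *)
Lemma theta_coef_step (a : 'I_N) i : (a <= lo i)%N ->
  t a (hi i) = sg i a * (if a == lo i then q ^ ((-1) ^+ par a) - q ^ (- (-1) ^+ par a)
                         else t a (lo i)).
Proof.
move=> alo.
have ahi : (a < hi i)%N by rewrite ltnS.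
have nah : (a == hi i) = false by rewrite -val_eqE ltn_eqF.
have := congr1 (mulmx (v a (hi i))) (theta_intertwines Theta_qR V V (f i)).
rewrite (mulmxA _ (R_act _ _ _)) (mulmxA _ (opcoprod_act _ _ _)).
rewrite tens_basis_R nah expr0z scale1r ahi mulmxDl -scalemxAl.
rewrite !coprod_act_f_row opcoprod_act_f_row nah eqxx !scale0r !addr0 !add0r -scalemxAl.
rewrite tens_basis_R !wform_eps (eq_sym (hi i)) nah (eq_sym (lo i)).
move=> /(congr1 (fun u : 'rV_(N * N) => u 0 (idx (lo i) a))).
have [E|nal] := eqVneq a (lo i).
  (* Here [v a (lo i)] and [v (lo i) a] coincide: [R] contributes the positive power of [q], and the
     [k_i^-1] leg of the coproduct the opposite power. *)
  rewrite -E ltnn addr0 !mxE !mxtens_index_eq !eqxx /= sub0r !mulr1.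
  move=> /(canRL (addKr _)) H; apply: (mulIf (f_coef_neq0 i)).
  by rewrite H; ring.
have lalo : (a < lo i)%N by rewrite ltn_neqAle val_eqE nal.
rewrite lalo !mxE !mxtens_index_eq (negbTE nal) !eqxx /= !andbF !mulr0 !add0r !mulr1.
by move=> H; apply: (mulIf (f_coef_neq0 i)); rewrite H; ring.
Qed.

(** Induction on [b], peeling off the simple root from [b - 1] to [b]. The sign [sg i a] changes
    [[a][b-1]] into [[a][b]] modulo 2. *)
Lemma theta_coefE (a b : 'I_N) : (a < b)%N -> t a b = (q - q^-1) * (-1) ^+ (par a && par b).
Proof.
have [k] := ubnP b; elim: k b => // k IHk b bk ab.
have bN : (b.-1 < N.-1)%N by have := ltn_ord b; lia.
pose i : 'I_N.-1 := Ordinal bN.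
have Eb : b = hi i by apply: val_inj => /=; lia.
rewrite Eb theta_coef_step; last by rewrite /=; lia.
rewrite /par_root; case: eqVneq => [E|nal].
  (* Replacing [q] by [q^-1] in the difference costs the sign [(-1)^[a]], which cancels the [[a][a]]
     part of [sg i a]. *)
  rewrite E; case: (par (lo i)); case: (par (hi i)) => /=;
    rewrite ?expr1 ?expr0 ?expr1z ?opprK ?expr1z ?exprN1 -?invr_expz ?expr1z; ring.
rewrite IHk; first last.
- by move: nal; rewrite -val_eqE /=; lia.
- by rewrite /=; lia.
by case: (par (lo i)); case: (par (hi i)); case: (par a) => /=; ring.
Qed.

(** * The braiding and its quadratic relation *)

Lemma braiding_row a b : v a b *m braiding Theta V =
  (-1) ^+ (par a && par b) *: (q ^ (if b == a then (-1) ^+ par b else 0) *: v b a) +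
  (if (b < a)%N then (q - q^-1) *: v a b else 0).
Proof.
rewrite mulmxA tens_basis_flip -scalemxAl tens_basis_R scalerDr; congr (_ + _).
case: ifP => [/theta_coefE->|]; last by rewrite scaler0.
rewrite scalerA andbC; congr (_ *: _).
(* The sign of the flip squares to 1 against the sign in [theta_coefE]. *)
by case: (_ && _); ring.
Qed.

Lemma braiding_quadratic : braiding Theta V *m braiding Theta V =
  (q - q^-1) *: braiding Theta V + 1%:M.
Proof.
apply: tens_basis_ext => a b.
rewrite mulmxDr mulmx1 -scalemxAr (mulmxA _ (braiding Theta V)) braiding_row.
rewrite mulmxDl -!scalemxAl braiding_row (fun_if (mulmx^~ _)) mul0mx -scalemxAl braiding_row.
rewrite (eq_sym b) -val_eqE; case: ltngtP => [ab|ba|/val_inj <-] /=.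
- by rewrite andbC; apply/rowP => k; rewrite !mxE expr0z; case: (_ && _); ring.
- by rewrite andbC; apply/rowP => k; rewrite !mxE expr0z; case: (_ && _); ring.
(* On [v a a] the braiding is the scalar [q] or [- q^-1], according to the parity of [a]; these are
   the two roots of the quadratic. *)
rewrite andbb; apply/rowP => k; rewrite !mxE; case: (par a).
  by rewrite expr1 exprN1; field.
by rewrite expr0 expr1z; field.
Qed.

End Theta.
End NaturalModule.

(* Factorization through the Hecke algebra *)
Local Close Scope classical_set_scope.
Local Close Scope ring_scope.

Theorem proposition3p1 (R : realType) (m n : nat) (par : 'I_(m + n) -> bool)
    (par_n : #|[pred a | par a]| = n)
    (Vq : wmodule (ratfun_q R) par (m + n)) (Vq_natural : is_natural Vq)
    (Theta : degree (m + n) -> tensUU (ratfun_q R) par)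
    (Theta_quasi_R : is_quasi_R Theta)
    (r : nat) (nu : braid r -> 'M[ratfun R]_((m + n) ^ r))
    (nu_rep : is_representation nu)
    (nu_gen : forall j : 'I_r.-1,
       nu (braid_gen j) = tens_at (braiding Theta Vq) j) :
  exists nu' : {rmorphism hecke (ratfun_q R) r -> 'M[ratfun R]_((m + n) ^ r)},
    scalable nu' /\ forall b : braid r, nu' (hecke_elt (ratfun_q R) b) = nu b.
Proof.
have q0 : (ratfun_q R != 0)%R by rewrite tofrac_eq0 polyX_eq0.
apply: hecke_factor => // j.
(* [tens_at] at a fixed position is linear, multiplicative and unital, so it carries the quadratic
   relation to the tensor power. *)
by rewrite nu_gen tens_at_mul braiding_quadratic // tens_at_linear tens_at1.
Qed.
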